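(* For integers $n\ge 4$ let $t(n)=2\binom{2n-3}{n-4}$ (the total number of internal triangles over all triangulations of a convex $(n+2)$-gon), so $t(4)=2$, $t(5)=14$, $t(6)=72,\dots$. There is no sequence of generalized action graphs for the sequence $\{s_n\}_{n\ge 0}$ with $s_0=1$ and $s_n=t(n+3)$ for $n\ge1$, that is, for the sequence $1,2,14,72,\dots$.
   Context: The numbers $t(n)$ also equal $(n+2)C_{n-1}-2C_n$, where $C_n=\frac{1}{n+1}\binom{2n}{n}$ is the $n$-th Catalan number. Generalized action graphs. Let $\{s_n\}_{n\ge0}$ be a sequence of positive integers. A sequence of generalized action graphs for $\{s_n\}$ is a sequence $\{G_n\}_{n\ge 0}$ of directed graphs whose vertices are labeled by non-negative integers such that: (Axiom 1) $G_0$ is the graph with $s_0$ vertices labeled $0$ and no edges. For $n\ge1$, $G_n$ is constructed from $G_{n-1}$ by adding $s_n$ new vertices, each labeled $n$; each new vertex is attached by exactly one new edge, directed from some vertex of $G_{n-1}$ to the new vertex, and no other edges are added (so each connected component is a directed tree rooted at a vertex labeled $0$). (Axiom 2) For every $n$ and every vertex $v$ of $G_n$, the subtree of $G_n$ with root $v$ is isomorphic to $G_k$ for some $k\le n$. Here the subtree with root $v$ is the induced subgraph on $v$ and its descendants (the vertices $w$ for which there is a directed path from $v$ to $w$), and isomorphisms are isomorphisms of directed graphs respecting labels up to adding one constant to all labels. (Axiom 3) Every leaf of $G_n$ (vertex with no outgoing edge) has label $n$. *)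

(* Defs.v *)
From mathcomp Require Import all_boot all_order all_algebra zify.
Set Implicit Arguments.
Unset Strict Implicit.
Unset Printing Implicit Defensive.

Record lgraph := LGraph {
  vert :> finType;
  edge : rel vert;
  lab : vert -> nat
}.

Arguments edge {_}.
Arguments lab {_}.

(* [connect] is reflexive-transitive, so the subtree contains its root. *)
Definition subtree (G : lgraph) (v : G) : lgraph :=
  @LGraph {w : G | connect edge v w}
    (fun x y => edge (val x) (val y))
    (fun x => lab (val x)).

(* The constant added to the labels may be negative, whence [int]. *)
Definition lgraph_iso (G H : lgraph) : Prop :=
  exists f : G -> H,
    [/\ bijective f,
        forall x y : G, edge (f x) (f y) = edge x y
      & exists c : int, forall x : G, (lab (f x))%:Z%R = ((lab x)%:Z + c)%R].

Definition initial_graph (m : nat) (G : lgraph) : Prop :=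
  [/\ #|G| = m,
      forall v : G, lab v = 0
    & forall u v : G, ~~ edge u v].

(* G is identified with its image under the embedding f; the new vertices are
   those outside [codom f]. *)
Definition extends_by (m n : nat) (G G' : lgraph) : Prop :=
  exists f : G -> G',
    [/\ injective f,
        forall v : G, lab (f v) = lab v,
        forall u v : G, edge (f u) (f v) = edge u v,
        #|[predC codom f]| = m
      & forall w : G', w \notin codom f ->
          [/\ lab w = n,
              exists u : G, forall x : G', edge x w = (x == f u)
            & forall x : G', ~~ edge w x]].

Definition leaf (G : lgraph) (v : G) : bool := [forall w, ~~ edge v w].

Definition generalized_action_graphs (s : nat -> nat) (G : nat -> lgraph) :
    Prop :=
  [/\ initial_graph (s 0) (G 0) /\
        (forall n, extends_by (s n.+1) n.+1 (G n) (G n.+1)),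
      forall n (v : G n), exists2 k, k <= n & lgraph_iso (subtree v) (G k)
    & forall n (v : G n), leaf v -> lab v = n].

(* Only used for n >= 4, where the subtractions are not truncated. *)
Definition t (n : nat) : nat := 2 * 'C(2 * n - 3, n - 4).

Definition triangle_seq (n : nat) : nat := if n == 0 then 1 else t (n + 3).

Lemma triangle_seq_gt0 n : 0 < triangle_seq n.
Proof.
by case: n => [|n]; rewrite /triangle_seq /t //= muln_gt0 bin_gt0 /=; lia.
Qed.

Example triangle_seq_init : map triangle_seq (iota 0 4) = [:: 1; 2; 14; 72].
Proof. by []. Qed.

(* Main.v *)
Require Import Defs.
From mathcomp Require Import all_boot all_order all_algebra.
From mathcomp Require Import zify.

(** Let [a k] be the number of vertices labeled [k] attached to the root of
[G k]. A vertex [v] labeled [j] in [G n] has a subtree whose labels range from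
[j] to [n], so the subtree is a copy of [G (n - j)] and [v] receives exactly
[a (n - j)] of the vertices labeled [n]. Counting the latter by their parents
gives [s n = \sum_(j < n) s j * a (n - j)]. For the sequence
1, 2, 14, 72, 330, ... this forces [a 1 = 2], [a 2 = 10], [a 3 = 24] and then
[a 4 = -2], which is absurd. *)

Definition children_labeled {G : lgraph} (n : nat) (v : G) : nat :=
  #|[pred w | edge v w & lab w == n]|.

(** An invariant carried along the extensions of Axiom 1, so that later arguments work inside a
    single graph, without the embeddings of [G n] into [G n.+1]. *)
Record graded (s : nat -> nat) (n : nat) (G : lgraph) : Prop := Graded {
  lab_le : forall v : G, lab v <= n;
  card_lab : forall j, j <= n -> #|[pred v : G | lab v == j]| = s j;
  edge_lab : forall u v : G, edge u v -> lab u < lab v;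
  parent : forall w : G, 0 < lab w -> exists u, forall x, edge x w = (x == u)
}.

Lemma graded_initial (s : nat -> nat) (G : lgraph) :
  initial_graph (s 0) G -> graded s 0 G.
Proof.
case=> cardG lab0 noedge; split.
- by move=> v; rewrite lab0.
- move=> j; rewrite leqn0 => /eqP->; rewrite -cardG.
  by apply: eq_card => v; rewrite !inE lab0.
- by move=> u v uv; have := noedge u v; rewrite uv.
- by move=> w; rewrite lab0.
Qed.

Lemma graded_extends (s : nat -> nat) (n : nat) (G G' : lgraph) :
  graded s n G -> extends_by (s n.+1) n.+1 G G' -> graded s n.+1 G'.
Proof.
move=> gG [f [finj flab fedge cardN new]].
have lab_old u : lab (f u) <= n by rewrite flab (lab_le _ _ _ gG).
(* New vertices have no outgoing edges, so every edge starts at an old vertex. *)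
have no_out w x : edge w x -> w \in codom f.
  by apply: contraTT => /new[_ _ /(_ x)].
split.
- move=> v; have [/codomP[u ->]|/new[-> //]] := boolP (v \in codom f).
  exact: leq_trans (lab_old u) _.
- move=> j; rewrite leq_eqVlt => /orP[/eqP->|ltj].
    rewrite -cardN; apply: eq_card => v; rewrite !inE.
    have [/codomP[u ->]|/new[-> _ _]] := boolP (v \in codom f); last exact: eqxx.
    by have := lab_old u; lia.
  rewrite -(card_lab _ _ _ gG j ltj) -(card_image finj).
  apply: eq_card => v; rewrite !inE.
  have [/codomP[u ->]|nv] := boolP (v \in codom f).
    by rewrite mem_image // inE flab.
  have [-> _ _] := new v nv; apply/idP/idP; first by lia.
  by case/imageP=> u _ ev; rewrite ev codom_f in nv.
- move=> u v uv; have /codomP[u0 eu] := no_out u v uv; subst u.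
  have [/codomP[v0 ev]|/new[-> _ _]] := boolP (v \in codom f).
    by subst v; rewrite !flab (edge_lab _ _ _ gG) // -fedge.
  by rewrite ltnS.
- move=> w; have [/codomP[w0 ->]|/new[_ [u uP] _] _] := boolP (w \in codom f);
    last by exists (f u).
  rewrite flab => /(parent _ _ _ gG)[u uP]; exists (f u) => x.
  have [/codomP[x0 ->]|nx] := boolP (x \in codom f).
    by rewrite fedge uP (inj_eq finj).
  have [_ _ /(_ (f w0))/negPf->] := new x nx.
  by apply/esym/negP => /eqP ex; rewrite ex codom_f in nx.
Qed.

Lemma connect_lab (s : nat -> nat) (n : nat) (G : lgraph) (v w : G) :
  graded s n G -> connect edge v w -> lab v <= lab w.
Proof.
move=> gG /connectP[p pth ->]; elim: p v pth => //= x p IHp v /andP[vx /IHp].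
by apply: leq_trans; apply: ltnW; apply: edge_lab gG _ _ vx.
Qed.

(** Labels strictly increase along edges, so a vertex of largest label among those reachable from
    [v] is a leaf. Through Axiom 3 this places a vertex labeled [n] below every vertex of [G n]. *)
Lemma connect_leaf (s : nat -> nat) (n : nat) (G : lgraph) (v : G) :
  graded s n G -> exists2 w, connect edge v w & leaf w.
Proof.
move=> gG; case: (arg_maxnP lab (connect0 edge v)) => w vw maxw.
exists w => //; apply/forallP => x; apply/negP => wx.
have := maxw x (connect_trans vw (connect1 wx)).
by have := edge_lab _ _ _ gG _ _ wx; rewrite /=; lia.
Qed.

(** Double counting: a vertex labeled [n.+1] has a positive label, hence exactly one parent. *)
Lemma children_labeled_sum (s : nat -> nat) (n : nat) (G : lgraph) :
  graded s n.+1 G -> s n.+1 = \sum_(v : G) children_labeled n.+1 v.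
Proof.
move=> gG; rewrite -(card_lab _ _ _ gG n.+1 (leqnn _)) -sum1_card.
under [RHS]eq_bigr => v _ do rewrite /children_labeled -sum1_card.
rewrite (exchange_big_dep (fun w : G => lab w == n.+1)) /=; last first.
  by move=> v w _; rewrite inE => /andP[].
apply: eq_big => [w|w]; rewrite !inE // => /eqP labw.
have [|u uP] := parent _ _ _ gG w; first by rewrite labw.
by rewrite (big_pred1 u) // => v; rewrite inE labw eqxx andbT uP.
Qed.

Lemma sum_lab (s : nat -> nat) (n : nat) (G : lgraph) (F : nat -> nat) :
  graded s n G -> \sum_(v : G) F (lab v) = \sum_(j < n.+1) s j * F j.
Proof.
move=> gG; rewrite (partition_big (fun v : G => inord (lab v) : 'I_n.+1) xpredT) //=.
apply: eq_bigr => j _; rewrite -(card_lab _ _ _ gG j); last by rewrite -ltnS.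
rewrite -sum_nat_const; apply: eq_big => v; last first.
  by move=> /eqP <-; rewrite inordK // ltnS (lab_le _ _ _ gG).
by rewrite inE -val_eqE /= inordK // ltnS (lab_le _ _ _ gG).
Qed.

Section ActionGraphs.

Context {s : nat -> nat} {G : nat -> lgraph}.
Context (s0 : s 0 = 1) (GP : generalized_action_graphs s G).

Lemma action_graph_graded n : graded s n (G n).
Proof.
have [[G0 Gext] _ _] := GP.
by elim: n => [|n IHn]; [apply: graded_initial | apply: graded_extends (Gext n)].
Qed.

Lemma action_graph_root n : exists r : G n, forall v, (lab v == 0) = (v == r).
Proof.
have := card_lab _ _ _ (action_graph_graded n) 0 (leq0n n).
rewrite s0 => /eqP/card1P[r rP].
by exists r => v; have := rP v; rewrite !inE.
Qed.

Lemma connect_max_lab n (v : G n) : exists2 w, connect edge v w & lab w = n.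
Proof.
have [_ _ leafP] := GP.
by have [w vw /leafP] := connect_leaf _ _ _ v (action_graph_graded n); exists w.
Qed.

(** Axiom 2 leaves both [k] and the added constant open; comparing the smallest and the largest
    labels on the two sides determines them. *)
Lemma subtree_shift n (v : G n) :
  exists f : subtree v -> G (n - lab v),
    [/\ bijective f, forall x y, edge (f x) (f y) = edge x y
      & forall x, lab x = lab (f x) + lab v].
Proof.
have [_ /(_ n v)[k _ [f [fbij fedge [c fc]]]] _] := GP.
have gG := action_graph_graded.
have lab_ge (x : subtree v) : lab v <= lab x by apply: connect_lab (gG n) (valP x).
have [g fK gK] := fbij.
pose v0 : subtree v := Sub v (connect0 edge v).
have labv0 : lab v0 = lab v by [].
have [r rP] := action_graph_root k.
have labr : lab r = 0 by apply/eqP; rewrite rP.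
(* The preimage of the root gives [c = - lab (g r)], which is at most [- lab v]; the image of [v0]
   has a nonnegative label, so [c] is at least [- lab v]. *)
have fcr := fc (g r); rewrite gK labr in fcr.
have fcv0 := fc v0; rewrite labv0 in fcv0.
have ger := lab_ge (g r).
have fE x : lab x = lab (f x) + lab v by have := fc x; lia.
suff ek : n - lab v = k by rewrite ek; exists f.
(* The image of [w], labeled [n - lab v], forces [n - lab v <= k]; the preimage of [w'], labeled
   [k + lab v], forces the converse. *)
have [w vw labw] := connect_max_lab n v.
have [w' _ labw'] := connect_max_lab k r.
have := fE (Sub w vw : subtree v).
rewrite [X in X = _](_ : _ = n) // => En.
have := lab_le _ _ _ (gG k) (f (Sub w vw)).
have := lab_le _ _ _ (gG n) (val (g w')).
have := fE (g w'); rewrite gK labw' /=; lia.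
Qed.

(** This is [a k] of the overview. Summing over the vertices labeled 0 avoids choosing the root,
    whose existence is only a proposition; when [s 0 = 1] there is a single summand. *)
Definition root_children (k : nat) : nat :=
  \sum_(r : G k | lab r == 0) children_labeled k r.

Lemma children_labeled_root n (v : G n) :
  children_labeled n v = root_children (n - lab v).
Proof.
have [f [[g fK gK] fedge flab]] := subtree_shift n v.
have [r rP] := action_graph_root (n - lab v).
pose v0 : subtree v := Sub v (connect0 edge v).
have fv0 : f v0 = r.
  apply/eqP; rewrite -rP; have := flab v0.
  by rewrite [X in X = _](_ : _ = lab v) //; lia.
have lev := lab_le _ _ _ (action_graph_graded n) v.
rewrite /root_children (big_pred1 r) // /children_labeled.
(* Every child of [v] lies in its subtree, so pulling back along [g] reaches all the children
   counted on the left. *)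
have ginj := can_inj gK.
have hinj : injective (fun x => val (g x)) by move=> x y /val_inj /ginj.
rewrite -(card_image hinj); apply: eq_card => w; rewrite !inE.
apply/andP/imageP => [[vw /eqP labw]|[x]].
  pose w0 : subtree v := Sub w (connect1 vw).
  exists (f w0); last by rewrite fK.
  rewrite inE -fv0 fedge [edge _ _]vw /=.
  by have := flab w0; rewrite [X in X = _](_ : _ = n) //; lia.
rewrite inE -fv0 -{1}[x]gK fedge => /andP[vx /eqP labx] ->; split=> //.
by have := flab (g x); rewrite gK labx /=; lia.
Qed.

Lemma action_graph_recurrence n :
  s n.+1 = \sum_(j < n.+1) s j * root_children (n.+1 - j).
Proof.
have gG := action_graph_graded n.+1.
rewrite (children_labeled_sum _ _ _ gG).
under eq_bigr => v _ do rewrite children_labeled_root.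
rewrite (sum_lab _ _ _ (fun j => root_children (n.+1 - j)) gG) big_ord_recr /=.
(* The vertices labeled [n.+1] contribute nothing: an edge of [G 0] cannot end at a vertex labeled
   0. *)
suff -> : root_children (n.+1 - n.+1) = 0 by rewrite muln0 addn0.
rewrite subnn /root_children big1 // => r _.
apply: eq_card0 => w; rewrite inE; apply/negP => /andP[rw /eqP labw].
by have := edge_lab _ _ _ (action_graph_graded 0) _ _ rw; rewrite labw.
Qed.

End ActionGraphs.

Theorem theorem4p2 :
  ~ exists G : nat -> lgraph, generalized_action_graphs triangle_seq G.
Proof.
case=> G GP; have rec := action_graph_recurrence (erefl : triangle_seq 0 = 1) GP.
(* The first three equations determine [root_children] at 1, 2 and 3; the fourth then reads
   [330 = 144 + 140 + 48 + root_children 4], whose right side is at least 332. *)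
have := (rec 0, rec 1, rec 2, rec 3); rewrite !big_ord_recr !big_ord0 /=.
have -> : triangle_seq 0 = 1 by [].
have -> : triangle_seq 1 = 2 by [].
have -> : triangle_seq 2 = 14 by [].
have -> : triangle_seq 3 = 72 by [].
have -> : triangle_seq 4 = 330 by [].
rewrite !subn0 => -[[[]]]; rewrite !subSS !subn0; lia.
Qed.
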